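(* Let $\alpha\in[0,1)$ and let $G$ be a tree of order $n\ge 4$. Then $\mu_{\alpha}(G)\ge\mu_{\alpha}(S_n)$, with equality if and only if $G\cong S_n$.
   Context: All graphs are finite, simple and undirected; $S_n$ is the star on $n$ vertices. For a connected graph $G$ with distance function $d_G$, the transmission of a vertex $u$ is $T_G(u)=\sum_{v\in V(G)}d_G(u,v)$, $T(G)$ is the diagonal matrix of transmissions and $D(G)=(d_G(u,v))_{u,v\in V(G)}$ the distance matrix. For $\alpha\in[0,1)$, $D_{\alpha}(G)=\alpha T(G)+(1-\alpha)D(G)$, and $\mu_{\alpha}(G)$ (the distance $\alpha$-spectral radius) is the largest eigenvalue of the symmetric matrix $D_{\alpha}(G)$. *)

(* Defs.v *)
From HB Require Import structures.
From mathcomp Require Import all_boot all_order all_algebra.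
From mathcomp Require Import classical_sets reals.

Set Implicit Arguments.
Unset Strict Implicit.
Unset Printing Implicit Defensive.

Import Order.TTheory GRing.Theory Num.Theory.

Local Open Scope ring_scope.

Record sgraph := SGraph {
  vertex :> finType;
  adj : rel vertex;
  adj_sym : symmetric adj;
  adj_irr : irreflexive adj
}.

Arguments adj {s} : rename.

Section Graphs.
Variable G : sgraph.
Implicit Types x y : G.

Definition connected_graph : Prop := forall x y, connect adj x y.

Definition acyclic_graph : Prop :=
  forall c : seq G, (2 < size c)%N -> ~~ (cycle adj c && uniq c).

Definition is_tree : Prop := connected_graph /\ acyclic_graph.

Definition has_path_of_length (k : nat) x y : bool :=
  [exists p : k.-tuple G,
    [&& path adj x p, last x p == y & uniq (x :: p)]].

(* The vertices of a path are distinct, so its length is less than [#|G|]; the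
   default value [#|G|] is taken only when [x] and [y] are not connected. *)
Definition gdist x y : nat :=
  \big[minn/#|G|]_(k < #|G| | has_path_of_length k x y) k.

Definition transmission x : nat := (\sum_y gdist x y)%N.

End Graphs.

Definition isomorphic (G H : sgraph) : Prop :=
  exists2 f : G -> H, bijective f & forall x y, adj (f x) (f y) = adj x y.

(* The centre is the vertex of value 0. *)
Definition star_adj (n : nat) : rel 'I_n :=
  fun i j => (i != j) && ((i == 0%N :> nat) || (j == 0%N :> nat)).

Lemma star_adj_sym n : symmetric (@star_adj n).
Proof. by move=> i j; rewrite /star_adj eq_sym orbC. Qed.

Lemma star_adj_irr n : irreflexive (@star_adj n).
Proof. by move=> i; rewrite /star_adj eqxx. Qed.

Definition star (n : nat) : sgraph :=
  SGraph (@star_adj_sym n) (@star_adj_irr n).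

Section DistanceAlpha.
Variable R : realType.

(* Rows and columns are indexed by the vertices through [enum_val]. *)
Definition transmission_mx (G : sgraph) : 'M[R]_#|G| :=
  diag_mx (\row_i (transmission (enum_val i))%:R).

Definition distance_mx (G : sgraph) : 'M[R]_#|G| :=
  \matrix_(i, j) (gdist (enum_val i) (enum_val j))%:R.

Definition distance_alpha_mx (alpha : R) (G : sgraph) : 'M[R]_#|G| :=
  alpha *: transmission_mx G + (1 - alpha) *: distance_mx G.

(* The set of eigenvalues is finite, so this supremum is a maximum as soon as
   there is an eigenvalue, in particular when [A] is symmetric and [0 < n]. *)
Definition largest_eigenvalue (n : nat) (A : 'M[R]_n) : R :=
  sup [set x : R | eigenvalue A x]%classic.

Definition mu (alpha : R) (G : sgraph) : R :=
  largest_eigenvalue (distance_alpha_mx alpha G).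

End DistanceAlpha.

(* Main.v *)
Require Import Defs.
From HB Require Import structures.
From mathcomp Require Import all_boot all_order all_algebra.
From mathcomp Require Import classical_sets reals.
From mathcomp Require Import perm complex zify ring.

Set Implicit Arguments.
Unset Strict Implicit.
Unset Printing Implicit Defensive.

Import Order.TTheory GRing.Theory Num.Theory.

Local Open Scope ring_scope.

(* Let [m = n - 1]. The Perron vector of the star takes a value [a] at the
   centre and [b] at the leaves. Put [a] at a vertex [c] of [G] of degree at
   least 2 and [b] at the other vertices. By Rayleigh's principle it suffices to
   compare the two quadratic forms on this vector, which only involve the
   transmission [T] of [c] and the sum [W] of the distances between vertices
   other than [c]. In the star these are [m] and [2m(m-1)]. In [G] clearly
   [m <= T], strictly unless [c] is adjacent to all other vertices, and then the
   tree [G] is a star. Moreover [2m(m-1) <= W]: an edge [uv] off [c], with [v]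
   farther from [c] than [u], is determined by [v], and its defect [2 - 1] is
   compensated by the pair made of [v] and a neighbour of [c] which is not on the
   path from [c] to [v], since this pair is at distance at least 3. *)

(** * Distances and geodesics in a connected graph *)

Section Distance.
Local Open Scope nat_scope.
Variable G : sgraph.
Implicit Types (u v x y : G) (p q : seq G).

(** A walk shortens to a simple path, whose length is below [#|G|] and so lies in the index range of
    the minimum. *)
Lemma gdist_le_size x p : path adj x p -> gdist x (last x p) <= size p.
Proof.
case/shortenP => p' xp' Up' sub_p'.
have lt_p' : size p' < #|G|.
  by have /card_uniqP /= <- := Up'; apply: max_card.
have le_p' : size p' <= size p by apply: uniq_leq_size => //; case/andP: Up'.
apply: leq_trans le_p'.
apply: (@bigmin_le_cond _ nat _ #|G| (Ordinal lt_p')).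
by apply/existsP; exists (in_tuple p'); rewrite xp' eqxx.
Qed.

Lemma gdistxx x : gdist x x = 0.
Proof. by apply/eqP; rewrite -leqn0 -[leqRHS]/(size (Nil G)) (@gdist_le_size x [::]). Qed.

Lemma adj_neq x y : adj x y -> x != y.
Proof. by apply: contraTneq => ->; rewrite adj_irr. Qed.

Hypothesis Gconn : connected_graph G.

Lemma geodesic x y :
  exists p, [/\ path adj x p, last x p = y, uniq (x :: p) & size p = gdist x y].
Proof.
have [p xp ->] := connectP (Gconn x y).
have lt_d : gdist x (last x p) < #|G|.
  case/shortenP: xp => p' xp' Up' _; apply: leq_ltn_trans (gdist_le_size xp') _.
  by have /card_uniqP /= <- := Up'; apply: max_card.
(* The minimum is either its default or attained; [lt_d] excludes the default. *)
pose P d := d = #|G| \/ has_path_of_length d x (last x p).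
have : P (gdist x (last x p)).
  apply: (big_ind P); [by left | move=> a b Ha Hb | by right].
  by rewrite /minn; case: ifP.
case=> [E|/existsP [t /and3P [xt /eqP Et Ut]]]; first by rewrite E ltnn in lt_d.
by exists t; rewrite size_tuple.
Qed.

Lemma gdist_eq0 x y : (gdist x y == 0) = (x == y).
Proof.
apply/eqP/eqP => [|->]; last exact: gdistxx.
by have [p [_ <- _ <-]] := geodesic x y => /size0nil ->.
Qed.

Lemma gdist_eq1 x y : (gdist x y == 1) = adj x y.
Proof.
apply/eqP/idP => [|xy].
  have [[|z [|? ?]] [//= xp <- _ <-]] := geodesic x y => // _.
  by case/andP: xp.
have: gdist x y <= 1.
  by have := @gdist_le_size x [:: y]; rewrite /= xy => /(_ isT).
have: gdist x y != 0 by rewrite gdist_eq0 adj_neq.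
by case: gdist => [|[]].
Qed.

Lemma gdist_sym x y : gdist x y = gdist y x.
Proof.
suff le_sym u v : gdist v u <= gdist u v by apply/anti_leq; rewrite !le_sym.
have [p [up <- _ <-]] := geodesic u v.
have -> : size p = size (rev (belast u p)) by rewrite size_rev size_belast.
have Eu : last (last u p) (rev (belast u p)) = u.
  by case: p {up} => //= a p; rewrite rev_cons last_rcons.
rewrite -{2}Eu; apply: gdist_le_size; rewrite rev_path.
by rewrite (eq_path (e' := adj)) // => ? ? /=; rewrite adj_sym.
Qed.

End Distance.

(** * Paths in acyclic graphs, and the sum of distances in a tree *)

Section Tree.
Local Open Scope nat_scope.
Variable G : sgraph.
Implicit Types (c u v x y : G) (p q : seq G).
Hypothesis Gacyclic : acyclic_graph G.

(* Two paths leaving [x] along different edges close up to a cycle as soon as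
   they meet again. *)
Lemma acyclic_fork x p q :
  path adj x p -> path adj x q -> uniq (x :: p) -> uniq (x :: q) ->
  has [in q] p -> head x p = head x q.
Proof.
move=> xp xq Up Uq Hpq; apply/eqP; apply: contraT => neq_pq.
(* Cut at the first vertex [z] of [p] that lies on [q]: then [p1] avoids [q], so going along [p1] to
   [z] and back along [q1] closes a cycle. It has more than 2 vertices, since with [p1] and [q1]
   both empty [z] would be the head of both paths. *)
move: xp Up neq_pq; case/split_find: {p} Hpq => z p1 p2 zq p1q xp Up neq_pq.
case/path.splitP: {q} zq xq Uq p1q neq_pq => q1 q2 xq Uq p1q neq_pq.
suff /Gacyclic/negP : 2 < size (x :: rcons p1 z ++ rev q1).
  case; apply/andP; split.
    rewrite /= rcons_cat cat_path; rewrite !cat_path in xp xq.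
    case/andP: xp => -> _ /=; rewrite last_rcons.
    have -> : rcons (rev q1) x = rev (belast x (rcons q1 z)).
      by rewrite belast_rcons rev_cons.
    rewrite -[z in path _ z](last_rcons x q1 z) rev_path.
    case/andP: xq => xq _; rewrite (eq_path (e' := adj)) // => ? ? /=.
    by rewrite adj_sym.
  move: Up Uq p1q; rewrite /= !mem_cat !negb_or !cat_uniq.
  case/and3P=> /andP [xp1 _] Up _ /and3P [/andP [xq1 _] Uq _].
  move: Uq xq1; rewrite rcons_uniq mem_rcons inE negb_or.
  move=> /andP [zq1 Uq] /andP [_ xq1] p1q.
  rewrite mem_rev xp1 xq1 Up rev_uniq Uq /= andbT.
  apply/hasPn => v; rewrite mem_rev => vq /=.
  rewrite mem_rcons inE negb_or; apply/andP; split.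
    by apply: contraNneq zq1 => <-.
  apply: contraNN p1q => vp; apply/hasP; exists v => //=.
  by rewrite mem_cat mem_rcons inE vq orbT.
rewrite /= size_cat size_rcons size_rev.
case: p1 neq_pq {xp Up p1q} => [|? ?] //=.
by case: q1 {xq Uq} => [|? ?] //=; rewrite ?eqxx // addnS.
Qed.

(** By [acyclic_fork], two nonempty paths with the same ends share their first edge; remove it and
    induct. *)
Lemma acyclic_path_inj x p q :
  path adj x p -> path adj x q -> uniq (x :: p) -> uniq (x :: q) ->
  last x p = last x q -> p = q.
Proof.
have last_nil (r : seq G) y : uniq (y :: r) -> last y r = y -> r = [::].
  by case: r => //= z r /andP [Ny _] E; rewrite -E mem_last in Ny.
elim: p x q => [|a p IHp] x [|b q] //.
- by move=> _ _ _ Uq /= /esym /(last_nil (b :: q)) ->.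
- by move=> _ _ Up _ /= /(last_nil (a :: p)) ->.
move=> xp xq Up Uq E; have Eab : a = b.
  apply: (acyclic_fork xp xq Up Uq); apply/hasP.
  by exists (last a p); [exact: mem_last | rewrite /= [last a p]E; exact: (mem_last b q)].
rewrite {}Eab in xp Up E *; congr (_ :: _); apply: (IHp b) => //.
- by case/andP: xp.
- by case/andP: xq.
- by case/andP: Up.
- by case/andP: Uq.
Qed.

Hypothesis Gconn : connected_graph G.

(* If [d(c,u) <= d(c,v)], the geodesic to [u] followed by [v] is a simple
   path, hence the only one from [c] to [v]. *)
Lemma geodesic_rcons c u v : adj u v -> gdist c u <= gdist c v ->
  exists p, [/\ last c p = u, gdist c v = (size p).+1 &
    path adj c (rcons p v) /\ uniq (c :: rcons p v)].
Proof.
move=> uv le_uv; have [p [cp Ep Up sp]] := geodesic Gconn c u.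
have Nv : v \notin c :: p.
  apply/negP => vp; case/splitPl: vp cp Ep sp {Up} => p1 p2 Ev.
  rewrite cat_path last_cat Ev size_cat => /andP [cp1 _] Eu sp.
  have := gdist_le_size cp1; rewrite Ev => le_v.
  have /size0nil p20 : size p2 = 0.
    apply/eqP; rewrite -leqn0 -(leq_add2l (size p1)) addn0 sp.
    exact: leq_trans le_v.
  by move: uv; rewrite -Eu p20 adj_irr.
have cpv : path adj c (rcons p v) by rewrite rcons_path cp Ep.
have Upv : uniq (c :: rcons p v) by rewrite -rcons_cons rcons_uniq Nv.
exists p; split=> //.
have [q [cq Eq Uq <-]] := geodesic Gconn c v.
by rewrite (acyclic_path_inj cq cpv) ?size_rcons // last_rcons.
Qed.

(** Trees are bipartite: at equal distances, [geodesic_rcons] would put [v] one step farther from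
    [c] than [u]. *)
Lemma gdist_adj_neq c u v : adj u v -> gdist c u != gdist c v.
Proof.
move=> uv; apply/eqP => E; have := geodesic_rcons uv (eq_leq E).
case=> p [Ep sp [cpv _]]; have : gdist c u <= size p.
  by rewrite -Ep gdist_le_size //; move: cpv; rewrite rcons_path => /andP [].
by rewrite E sp ltnn.
Qed.

(** Both [u1] and [u2] are the last vertex before [v] on the unique simple path from [c] to [v]. *)
Lemma closer_neighbour_uniq c v u1 u2 : adj u1 v -> adj u2 v ->
  gdist c u1 < gdist c v -> gdist c u2 < gdist c v -> u1 = u2.
Proof.
move=> /geodesic_rcons H1 /geodesic_rcons H2 /ltnW/H1 [p [<- _ [cp Up]]].
move=> /ltnW/H2 [q [<- _ [cq Uq]]].
have := acyclic_path_inj cp cq Up Uq; rewrite !last_rcons => /(_ erefl).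
by move/rcons_inj => [->].
Qed.

Variable c : G.

(** With the tree rooted at [c], [up u v] makes [u] the parent of [v], and [far] collects the pairs
    that compensate for edges. The conditions on distances to [c] prevent [far u v] and [far v u]
    from both holding. *)
Let up u v := adj u v && (gdist c u < gdist c v).
Let far u v := [&& adj c u, 1 < gdist c v & 2 < gdist u v].

(** At distance 1 exactly one [up] term supplies the missing unit; at distance 2 the [far] terms
    vanish; from 3 on the surplus pays for the single possible [far] term. *)
Lemma up_far_gdist u v :
  2 * (u != v) + (far u v + far v u) <= gdist u v + (up u v + up v u).
Proof.
have [<-|neq_uv] := eqVneq u v; first by rewrite /far gdistxx !andbF.
have d0 : gdist u v != 0 by rewrite gdist_eq0.
have Efar : far u v + far v u <= 1.
  rewrite /far -!(gdist_eq1 Gconn).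
  by case: eqP => [->|_] /=; rewrite ?andbF ?addn0 leq_b1.
have Nfar : gdist u v <= 2 -> far u v + far v u = 0.
  by move=> d2; rewrite /far ![2 < _]ltnNge [gdist v u]gdist_sym // d2 !andbF.
have Eup : gdist u v = 1 -> up u v + up v u = 1.
  move/eqP; rewrite gdist_eq1 // => uv; rewrite /up [adj v u]adj_sym uv.
  by have := gdist_adj_neq c uv; case: ltngtP.
by case: (gdist u v) d0 Nfar Eup => [|[|[|d]]] //= _ Nfar Eup; lia.
Qed.

Hypothesis deg_c : exists u1 u2, [/\ adj c u1, adj c u2 & u1 != u2].

(** A neighbour of [c] has no parent other than [c]. A deeper vertex has at most one parent, and at
    least one neighbour of [c] is far from it. *)
Lemma up_le_far v : v != c ->
  \sum_(u | u != c) up u v <= \sum_(u | u != c) far u v.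
Proof.
move=> vc; have [d1|d1] := ltnP 1 (gdist c v); last first.
  rewrite big1 // => u uc; rewrite /up [_ < _]leqNgt.
  rewrite (leq_ltn_trans d1) ?andbF //.
  by rewrite ltnS lt0n gdist_eq0 // eq_sym.
have [u1 [u2 [cu1 cu2 neq_u]]] := deg_c.
(* Seen from [v], [c] has only one closer neighbour and none at equal distance, so [u1] or [u2] is
   farther from [v] than [c] is. *)
have [u cu lt_u] : exists2 u, adj c u & gdist v c < gdist v u.
  have := gdist_adj_neq v cu2; have := gdist_adj_neq v cu1.
  case: (ltngtP (gdist v c) (gdist v u1)) => [? _|lt1 _|] //; first by exists u1.
  case: (ltngtP (gdist v c) (gdist v u2)) => [? _|lt2 _|] //; first by exists u2.
  case/eqP: neq_u; apply: (closer_neighbour_uniq _ _ lt1 lt2).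
    by rewrite adj_sym.
  by rewrite adj_sym.
have far_u : far u v.
  rewrite /far cu d1 gdist_sym //; apply: leq_ltn_trans lt_u.
  by rewrite gdist_sym.
have uc : u != c by rewrite eq_sym adj_neq.
apply: (@leq_trans 1); last by rewrite (bigD1 u) //= far_u.
have [w /andP [wc up_w]|up0] := pickP [pred w | (w != c) && up w v].
  rewrite (bigD1 w) //= big1 ?addn0 ?leq_b1 // => w' /andP [w'c neq_w].
  apply/eqP; rewrite eqb0; apply: contraNN neq_w => up_w'.
  case/andP: up_w up_w' => wv lt_w /andP [w'v lt_w'].
  by apply/eqP/(closer_neighbour_uniq w'v wv lt_w' lt_w).
rewrite big1 // => w wc; have := up0 w; rewrite /= wc /= => ->.
by [].
Qed.

Lemma sum_gdist_punctured :
  2 * (#|G|.-1 * #|G|.-2) <= \sum_(u | u != c) \sum_(v | v != c) gdist u v.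
Proof.
have Ene : \sum_(u | u != c) \sum_(v | v != c) (u != v) = #|G|.-1 * #|G|.-2.
  transitivity (\sum_(u | u != c) #|G|.-2); last first.
    rewrite sum_nat_const; congr (_ * _).
    by rewrite -(cardC1 c); apply: eq_card.
  apply: eq_bigr => u uc; rewrite (bigD1 u) //= eqxx.
  under eq_bigr => v /andP [_ vu] do rewrite eq_sym vu.
  rewrite sum1_card; transitivity #|~: [set c; u]|.
    by apply: eq_card => v; rewrite !inE negb_or.
  by rewrite -(cardsC [set c; u]) cards2 eq_sym uc.
have le_uf : \sum_(u | u != c) \sum_(v | v != c) up u v <=
    \sum_(u | u != c) \sum_(v | v != c) far u v.
  (* [up_le_far] fixes the second vertex, so this one is summed outermost. *)
  rewrite exchange_big [leqRHS]exchange_big.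
  by apply: leq_sum => v vc; apply: up_le_far.
have split2 (f g : G -> G -> nat) :
    \sum_(u | u != c) \sum_(v | v != c) (f u v + g u v) =
    \sum_(u | u != c) \sum_(v | v != c) f u v +
    \sum_(u | u != c) \sum_(v | v != c) g u v.
  by rewrite -big_split; apply: eq_bigr => u _; rewrite big_split.
have sym_sum (f : rel G) : \sum_(u | u != c) \sum_(v | v != c) (f u v + f v u) =
    2 * \sum_(u | u != c) \sum_(v | v != c) f u v.
  by rewrite split2 [X in _ + X]exchange_big mul2n -addnn.
(* Pairs are ordered, so each of [up] and [far] is counted twice, and [le_uf] cancels them. *)
have : \sum_(u | u != c) \sum_(v | v != c) (2 * (u != v) + (far u v + far v u)) <=
    \sum_(u | u != c) \sum_(v | v != c) (gdist u v + (up u v + up v u)).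
  by do 2![apply: leq_sum => ? _]; apply: up_far_gdist.
rewrite split2 (sym_sum far) split2 (sym_sum up) -Ene.
under eq_bigr do rewrite -big_distrr.
rewrite -big_distrr /=.
move: le_uf; lia.
Qed.

End Tree.

(** * Rayleigh's principle for real symmetric matrices, by complexification *)

Section Rayleigh.
Local Open Scope sesquilinear_scope.
Local Open Scope complex_scope.

Lemma real_complex_hermsym (R : rcfType) (n : nat) (A : 'M[R]_n) :
  A^T = A -> map_mx (real_complex R) A \is hermsymmx.
Proof.
move=> Asym; apply: realsym_hermsym.
  apply/is_hermitianmxP.
  by rewrite expr0 scale1r map_mx_id // map_trmx Asym.
by apply/mxOverP => j k; rewrite mxE; apply/complex_realP; exists (A j k).
Qed.

Lemma spectral_diag_eigenvalue (R : rcfType) (n : nat) (A : 'M[R]_n) (i : 'I_n) :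
  A^T = A ->
  exists2 r : R, spectral_diag (map_mx (real_complex R) A) 0 i = r%:C &
    eigenvalue A r.
Proof.
move/real_complex_hermsym; set A' := map_mx _ A => A'herm.
have /mxOverP /(_ 0 i) /complex_realP [r Er] := hermitian_spectral_diag_real A'herm.
exists r => //.
(* Being a root of the characteristic polynomial can be tested over the complex numbers, where a row
   of [spectralmx] is an eigenvector. *)
rewrite eigenvalue_root_char -(fmorph_root (real_complex R)) map_char_poly.
rewrite -eigenvalue_root_char; apply/eigenvalueP.
have /hermitian_normalmx /orthomx_spectralP EA := A'herm.
exists (row i (spectralmx A')).
  rewrite -/A' {2}EA -!mulmxA -row_mul mulKVmx ?spectral_unit // row_mul.
  by rewrite row_diag_mx -scalemxAl -rowE Er.
apply: contraTneq (spectral_unit A') => P0.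
by rewrite -row_free_unit; apply/row_freePn; exists i; rewrite P0 sub0mx.
Qed.

(** In the coordinates [y] of [x] in a unitary eigenbasis, the form is a sum of eigenvalues weighted
    by squared moduli. *)
Lemma rayleigh_le (R : rcfType) (n : nat) (A : 'M[R]_n) (M : R) (x : 'rV_n) :
  A^T = A -> (forall r, eigenvalue A r -> r <= M) ->
  (x *m A *m x^T) 0 0 <= M * (x *m x^T) 0 0.
Proof.
move=> Asym AM; rewrite -lecR.
have := @spectral_diag_eigenvalue R n A ^~ Asym.
have := real_complex_hermsym Asym.
set A' := map_mx _ A => /hermitian_normalmx /orthomx_spectralP EA dP.
set P := spectralmx A' in EA *; set d := spectral_diag A' in EA dP *.
have Pu : P \is unitarymx := spectral_unitarymx A'.
pose x' := map_mx (real_complex R) x; pose y := x' *m P^t*.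
have x'T : x'^T = x'^t*.
  by apply/matrixP => i j; rewrite !mxE; apply/esym/CrealP/complex_realP; eexists.
have yT : y^t* = P *m x'^T.
  by rewrite /y trmx_mul map_mxM trmxCK -x'T.
have El : ((x *m A *m x^T) 0 0)%:C = (y *m diag_mx d *m y^t*) 0 0.
  have -> : y *m diag_mx d *m y^t* = x' *m A' *m x'^T.
    by rewrite yT /y -(invmx_unitary Pu) [in RHS]EA !mulmxA.
  by rewrite map_trmx -!map_mxM [RHS]mxE.
have Er : ((x *m x^T) 0 0)%:C = (y *m y^t*) 0 0.
  rewrite yT /y mulmxA mulmxKtV //.
  by rewrite map_trmx -!map_mxM [RHS]mxE.
rewrite rmorphM /= El Er mul_mx_diag !mxE mulr_sumr ler_sum // => i _.
rewrite !mxE; have [r -> /AM rM] := dP i.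
by rewrite mulrAC mulrC ler_wpM2r ?lecR // mul_conjC_ge0.
Qed.
End Rayleigh.

(** * Vertices of degree at least 2, and recognition of the star *)

Section TreeShape.
Local Open Scope nat_scope.
Variable G : sgraph.
Implicit Types c u v : G.

(** If some vertex is at distance at least 2 from [x], the second vertex of a geodesic to it works;
    otherwise [x] itself does. *)
Lemma exists_branch : connected_graph G -> 2 < #|G| ->
  exists c u1 u2 : G, [/\ adj c u1, adj c u2 & u1 != u2].
Proof.
move=> Gconn G2; have /card_gt0P [x _] := ltn_trans (ltn0Sn 1) G2.
have [z d_z|all_adj] := pickP [pred z | 1 < gdist x z].
  have [p [xp _ Up sp]] := geodesic Gconn x z.
  case: p sp xp Up => [|y [|y' p]] sp; rewrite /= -sp // in d_z *.
  case/and3P=> xy yy' _ /andP [+ _]; rewrite !inE !negb_or => /and3P [_ xy' _].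
  by exists y, x, y'; rewrite [adj y x]adj_sym.
have adj_x y : y != x -> adj x y.
  move=> yx; rewrite -gdist_eq1 //; have /negbT := all_adj y; rewrite /= -leqNgt.
  have : gdist x y != 0 by rewrite gdist_eq0 // eq_sym.
  by case: (gdist x y) => [|[]].
have [] : exists u1 u2 : G, [/\ u1 \in predC1 x, u2 \in predC1 x & u1 != u2].
  have : 1 < #|predC1 x| by rewrite cardC1; case: #|G| G2 => [|[|]].
  by case/card_gt1P => u1 [u2 [? ? ?]]; exists u1, u2.
by move=> u1 [u2 [/adj_x ? /adj_x ? ?]]; exists x, u1, u2.
Qed.

Lemma universal_star c : is_tree G -> (forall v, v != c -> adj c v) ->
  isomorphic G (star #|G|).
Proof.
case=> Gconn Gacyc adj_c.
have G0 : 0 < #|G| by apply/card_gt0P; exists c.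
(* The transposition moves the rank of [c] to 0, the centre of the star. *)
pose z := Ordinal G0; pose f v : star #|G| := tperm (enum_rank c) z (enum_rank v).
have f_inj : injective f by move=> u v /perm_inj /enum_rank_inj.
have fc v : (f v == 0 :> nat) = (v == c).
  rewrite -[LHS]/(f v == z); have -> : z = f c by rewrite /f tpermL.
  exact: inj_eq.
exists f; first by apply: inj_card_bij => //; rewrite card_ord.
move=> u v; rewrite -[LHS]/(star_adj (f u) (f v)) /star_adj !fc (inj_eq f_inj).
have [-> | uc] := eqVneq u c.
  have [->|vc] := eqVneq v c; first by rewrite adj_irr.
  by rewrite adj_c //= andbT.
have [-> | vc] := eqVneq v c; first by rewrite adj_sym adj_c ?uc.
(* Both vertices are at distance 1 from [c], so they cannot be adjacent. *)
rewrite andbF; apply/esym/negP => /(gdist_adj_neq Gacyc Gconn c)/negP; apply.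
have d1 w : w != c -> gdist c w = 1.
  by move=> wc; apply/eqP; rewrite gdist_eq1 ?adj_c.
by rewrite !d1.
Qed.

End TreeShape.

(** * Distances in the star *)

Section StarDistance.
Local Open Scope nat_scope.
Variable n : nat.
Let c : star n.+1 := ord0.

Lemma star_adj0 (v : star n.+1) : adj c v = (v != c).
Proof. by rewrite /adj /= /star_adj /= andbT eq_sym. Qed.

Lemma star_connected : connected_graph (star n.+1).
Proof.
have c_conn v : connect adj c v.
  by have [->|vc] := eqVneq v c; rewrite ?connect0 // connect1 ?star_adj0.
have sym : connect_sym (@adj (star n.+1)) by apply: sym_connect_sym; apply: adj_sym.
by move=> u v; apply: connect_trans (c_conn v); rewrite sym.
Qed.

Lemma gdist_star0 v : gdist c v = (v != c).
Proof.
have [->|vc] := eqVneq v c; first by rewrite gdistxx.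
by apply/eqP; rewrite (gdist_eq1 star_connected) star_adj0.
Qed.

Lemma gdist_star u v : u != c -> v != c -> gdist u v = 2 * (u != v).
Proof.
move=> uc vc; have [->|uv] := eqVneq u v; first by rewrite gdistxx.
have : gdist u v <= 2.
  apply: (@gdist_le_size _ u [:: c; v]); apply/and3P.
  by rewrite adj_sym !star_adj0.
have : gdist u v != 0 by rewrite (gdist_eq0 star_connected).
have : gdist u v != 1.
  rewrite (gdist_eq1 star_connected) /adj /= /star_adj negb_and negb_or.
  by rewrite -[_ == 0]/(u == c) -[(v : 'I_ _) == 0 :> nat]/(v == c) uc vc orbT.
by case: (gdist u v) => [|[|[|]]].
Qed.

End StarDistance.

(** * Distances under homomorphisms and isomorphisms *)

Lemma gdist_hom (G H : sgraph) (f : G -> H) x y : connected_graph G ->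
  {homo f : u v / adj u v} -> (gdist (f x) (f y) <= gdist x y)%N.
Proof.
move=> Gconn fhom; have [p [xp <- _ <-]] := geodesic Gconn x y.
rewrite -(last_map f) -(size_map f); apply: gdist_le_size.
by rewrite path_map (sub_path _ xp) // => u v; apply: fhom.
Qed.

Lemma isomorphic_sym (G H : sgraph) : isomorphic G H -> isomorphic H G.
Proof.
case=> f [g fK gK] fadj; exists g; first by exists f.
by move=> x y; rewrite -fadj !gK.
Qed.

Lemma isomorphic_gdist (G H : sgraph) (f : G -> H) x y :
  connected_graph G -> connected_graph H -> bijective f ->
  (forall u v, adj (f u) (f v) = adj u v) -> gdist (f x) (f y) = gdist x y.
Proof.
move=> Gconn Hconn [g fK gK] fadj; apply/anti_leq/andP; split.
  by apply: gdist_hom => // u v; rewrite fadj.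
rewrite -{1}[x]fK -{1}[y]fK; apply: gdist_hom => // u v.
by rewrite -fadj !gK.
Qed.

(** * Eigenvalue bounds and positive eigenvectors *)

Section Spectrum.
Variable R : realType.

(** Read the eigenvector equation at an index [j] where the ratio of [|v j|] to [w j] is maximal. *)
Lemma eigenvalue_norm_le (n : nat) (A : 'M[R]_n) (w : 'I_n -> R) (M r : R) :
  (forall i, 0 < w i) -> (forall j, \sum_i `|A i j| * w i <= M * w j) ->
  eigenvalue A r -> `|r| <= M.
Proof.
move=> w0 AM /eigenvalueP [v vA /rV0Pn [j0 vj0]].
have [j _ jmax] := @arg_maxP _ _ _ j0 xpredT (fun i => `|v 0 i| / w i) isT.
have t0 : 0 < `|v 0 j| / w j.
  by apply: lt_le_trans (jmax j0 isT); rewrite divr_gt0 ?normr_gt0.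
have vj : 0 < `|v 0 j| by rewrite pmulr_lgt0 ?invr_gt0 in t0.
rewrite -(ler_pM2r vj) -normrM.
have /rowP /(_ j) := vA; rewrite !mxE => <-.
apply: le_trans (ler_norm_sum _ _ _) _.
have -> : M * `|v 0 j| = (`|v 0 j| / w j) * (M * w j).
  by field; rewrite gt_eqF.
apply: le_trans (ler_wpM2l (ltW t0) (AM j)).
rewrite mulr_sumr ler_sum // => i _.
rewrite normrM [`|A i j| * _]mulrC mulrA ler_wpM2r //.
by rewrite -ler_pdivrMr //; apply: jmax.
Qed.

Lemma le_largest_eigenvalue (n : nat) (A : 'M[R]_n) (r : R) :
  eigenvalue A r -> r <= largest_eigenvalue A.
Proof.
move=> Ar; apply: sup_upper_bound => //; split; first by exists r.
exists (\sum_i \sum_j `|A i j|) => s As; apply: le_trans (ler_norm s) _.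
apply: (@eigenvalue_norm_le _ _ (fun=> 1)) As => // j.
under eq_bigr do rewrite mulr1.
by rewrite mulr1 ler_sum // => i _; rewrite (bigD1 j) //= lerDl sumr_ge0.
Qed.

(** The positive eigenvector serves as the weights in [eigenvalue_norm_le], which then bounds every
    eigenvalue by [M]. *)
Lemma perron_largest_eigenvalue (n : nat) (A : 'M[R]_n) (w : 'rV_n) (M : R) :
  (0 < n)%N -> (forall i j, 0 <= A i j) -> (forall i, 0 < w 0 i) ->
  w *m A = M *: w -> largest_eigenvalue A = M.
Proof.
move=> n0 A0 w0 wA; apply/le_anti/andP; split.
  apply: sup_le_ub; first exists M => /=.
    apply/eigenvalueP; exists w => //; apply/rV0Pn; exists (Ordinal n0).
    by rewrite gt_eqF.
  move=> r /= Ar; apply: le_trans (ler_norm r) _.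
  apply: (@eigenvalue_norm_le _ _ (fun i => w 0 i)) Ar => // j.
  have /rowP /(_ j) := wA; rewrite !mxE => <-.
  by apply/ler_sum => i _; rewrite ger0_norm // mulrC.
apply: le_largest_eigenvalue; apply/eigenvalueP; exists w => //.
by apply/rV0Pn; exists (Ordinal n0); rewrite gt_eqF.
Qed.

End Spectrum.

(** * The matrix [distance_alpha_mx] acting on functions of the vertices *)

Section DistanceAlphaVertices.
Variables (R : realType) (alpha : R).

Definition dalpha (G : sgraph) (u v : G) : R :=
  alpha * ((transmission u)%:R *+ (u == v)) + (1 - alpha) * (gdist u v)%:R.

Lemma distance_alpha_mxE (G : sgraph) i j :
  distance_alpha_mx alpha G i j = dalpha (enum_val i) (enum_val j).
Proof. by rewrite /dalpha !mxE (inj_eq enum_val_inj). Qed.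

Lemma sum_enum_val (G : finType) (F : G -> R) :
  \sum_(i < #|G|) F (enum_val i) = \sum_u F u.
Proof. by rewrite [RHS](reindex (@enum_val G G)) //; apply/onW_bij/enum_val_bij. Qed.

Lemma mulmx_dalpha (G : sgraph) (x : G -> R) j :
  ((\row_i x (enum_val i)) *m distance_alpha_mx alpha G) 0 j =
  \sum_u x u * dalpha u (enum_val j).
Proof.
rewrite mxE -(sum_enum_val (fun u => x u * dalpha u (enum_val j))).
by apply: eq_bigr => i _; rewrite distance_alpha_mxE mxE.
Qed.

Lemma eigenvalue_dalphaP (G : sgraph) (r : R) :
  eigenvalue (distance_alpha_mx alpha G) r <->
  exists2 x : G -> R, (exists u, x u != 0) &
    forall v, \sum_u x u * dalpha u v = r * x v.
Proof.
split=> [/eigenvalueP [w wA /rV0Pn [j wj]]|[x [u xu] xA]].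
  have Ew : w = \row_i w 0 (enum_rank (enum_val i)).
    by apply/rowP => i; rewrite mxE enum_valK.
  exists (fun v => w 0 (enum_rank v)).
    by exists (enum_val j); rewrite enum_valK.
  move=> v; rewrite -[v]enum_rankK -(mulmx_dalpha (fun v => w 0 (enum_rank v))).
  by rewrite -Ew wA !mxE enum_rankK.
apply/eigenvalueP; exists (\row_i x (enum_val i)).
  by apply/rowP => j; rewrite mulmx_dalpha xA !mxE.
by apply/rV0Pn; exists (enum_rank u); rewrite mxE enum_rankK.
Qed.

(** Distances and transmissions are preserved, so an eigenvector of [H] pulls back to one of [G]. *)
Lemma isomorphic_eigenvalue (G H : sgraph) (r : R) :
  connected_graph G -> connected_graph H -> isomorphic G H ->
  eigenvalue (distance_alpha_mx alpha H) r ->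
  eigenvalue (distance_alpha_mx alpha G) r.
Proof.
move=> Gconn Hconn [f f_bij fadj] /eigenvalue_dalphaP [x [u xu] xA].
have fd := isomorphic_gdist _ _ Gconn Hconn f_bij fadj.
have f_inj := bij_inj f_bij.
have fT v : transmission (f v) = transmission v.
  rewrite /transmission (reindex f); last exact: onW_bij.
  by apply: eq_bigr => w _; apply: fd.
apply/eigenvalue_dalphaP; exists (x \o f).
  by case: f_bij => g _ gK; exists (g u); rewrite /= gK.
move=> v; rewrite /= -xA [RHS](reindex f); last exact: onW_bij.
by apply: eq_bigr => w _; rewrite /dalpha fd fT (inj_eq f_inj).
Qed.

Lemma isomorphic_mu (G H : sgraph) :
  connected_graph G -> connected_graph H -> isomorphic G H ->
  mu alpha G = mu alpha H.
Proof.
move=> Gconn Hconn GH; rewrite /mu /largest_eigenvalue; congr sup.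
by apply/seteqP; split=> r /=; apply: isomorphic_eigenvalue => //;
  apply: isomorphic_sym.
Qed.

(** Expanding the transmission of [v] leaves one sum weighted by distances, the form in which trees
    are compared. *)
Lemma sum_dalpha (G : sgraph) (x : G -> R) v : connected_graph G ->
  \sum_u x u * dalpha u v =
  \sum_u (gdist v u)%:R * (alpha * x v + (1 - alpha) * x u).
Proof.
move=> Gconn; rewrite /dalpha.
under eq_bigr do rewrite mulrDr.
under [RHS]eq_bigr do rewrite mulrDr.
rewrite !big_split /=; congr (_ + _).
  rewrite (bigD1 v) //= eqxx big1 ?addr0.
    by rewrite -mulr_suml -natr_sum mulr1n /transmission; ring.
  by move=> u /negPf ->; rewrite mulr0n !mulr0.
by apply: eq_bigr => u _; rewrite gdist_sym //; ring.
Qed.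

Lemma mu_rayleigh (G : sgraph) (x : G -> R) : connected_graph G ->
  \sum_v \sum_u (gdist v u)%:R * (alpha * x v + (1 - alpha) * x u) * x v <=
  mu alpha G * \sum_v x v ^+ 2.
Proof.
move=> Gconn.
have Asym : (distance_alpha_mx alpha G)^T = distance_alpha_mx alpha G.
  apply/matrixP => i j; rewrite mxE !distance_alpha_mxE /dalpha gdist_sym //.
  by rewrite eq_sym; case: eqP => [->|].
have := rayleigh_le (\row_i x (enum_val i)) Asym (@le_largest_eigenvalue _ _ _).
rewrite !mxE; set lhs := (X in X <= _); set rhs := (X in _ <= X).
set lhs' := (X in _ -> X <= _); set rhs' := (X in _ -> _ <= X).
have -> : lhs' = lhs.
  rewrite /lhs /lhs' -sum_enum_val; apply: eq_bigr => i _.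
  by rewrite mulmx_dalpha !mxE sum_dalpha // mulr_suml.
have -> // : rhs' = rhs.
rewrite /rhs /rhs' -sum_enum_val; congr (_ * _).
by apply: eq_bigr => i _; rewrite !mxE expr2.
Qed.

End DistanceAlphaVertices.

(** * Comparison with the Perron vector of the star *)

Section Comparison.
Variables (R : realType) (alpha : R).
Hypotheses (alpha_ge0 : 0 <= alpha) (alpha_lt1 : alpha < 1).

(* [D_alpha] of the star with [m] leaves acts on the vectors with value [a] at
   the centre and [b] at the leaves by the two equations below. *)
Lemma star_perron (m : R) : 0 < m -> exists a b M : R,
  [/\ 0 < a, 0 < b, M * a = alpha * m * a + (1 - alpha) * m * b &
      M * b = (2 * (m - 1) + alpha) * b + (1 - alpha) * a].
Proof.
move=> m0; pose q := 2 * (m - 1) + alpha; pose d := alpha * m - q.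
pose D := d ^+ 2 + 4 * (1 - alpha) ^+ 2 * m; pose s := Num.sqrt D.
have al : 0 < 1 - alpha by rewrite subr_gt0.
have Dd : d ^+ 2 < D.
  by rewrite ltrDl !mulr_gt0 // exprn_gt0.
have D0 : 0 <= D by apply: le_trans (ltW Dd); apply: sqr_ge0.
have s2 : s ^+ 2 = D by apply: sqr_sqrtr.
have ds : d < s.
  apply: le_lt_trans (ler_norm d) _.
  by rewrite -sqrtr_sqr ltr_sqrt //; apply: le_lt_trans Dd; apply: sqr_ge0.
(* [M] is the larger eigenvalue of the 2 by 2 system, with discriminant [D]. The first equation
   allows [a = (1 - alpha) * m] and [b = M - alpha * m]; here [ds] makes [b] positive. *)
exists ((1 - alpha) * m), ((s - d) / 2), ((alpha * m + q + s) / 2); split.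
- exact: mulr_gt0.
- by rewrite divr_gt0 ?subr_gt0.
- by rewrite /d; field.
- have -> : (alpha * m + q + s) / 2 * ((s - d) / 2) =
      q * ((s - d) / 2) + (s ^+ 2 - d ^+ 2) / 4 by rewrite /d; field.
  by rewrite s2 /D -/q; field.
Qed.

Let profile (G : sgraph) (c : G) (a b : R) v := if v == c then a else b.

(** [F] takes the value of the profile as a separate argument, so that each occurrence to be split
    can be selected. *)
Lemma sum_profile (G : sgraph) (c : G) (a b : R) (F : G -> R -> R) :
  \sum_v F v (profile c a b v) = F c a + \sum_(v | v != c) F v b.
Proof.
rewrite (bigD1 c) //= /profile eqxx; congr (_ + _).
by apply: eq_bigr => v /negPf ->.
Qed.

Lemma mu_star (m : nat) (a b M : R) : 0 < a -> 0 < b ->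
  M * a = alpha * m%:R * a + (1 - alpha) * m%:R * b ->
  M * b = (2 * (m%:R - 1) + alpha) * b + (1 - alpha) * a ->
  mu alpha (star m.+1) = M.
Proof.
move=> a0 b0 Ea Eb; set c : star m.+1 := ord0.
have Gconn := @star_connected m.
have cardc : #|predC1 c| = m by rewrite cardC1 card_ord.
apply: (perron_largest_eigenvalue (w := \row_i profile c a b (enum_val i))).
- by rewrite card_ord.
- move=> i j; rewrite distance_alpha_mxE addr_ge0 // mulr_ge0 ?mulrn_wge0 //.
  by rewrite subr_ge0 ltW.
- by move=> i; rewrite mxE /profile; case: ifP.
apply/rowP => j; rewrite mulmx_dalpha !mxE sum_dalpha //.
set v := enum_val j; rewrite (sum_profile c a b
  (fun u y => (gdist v u)%:R * (alpha * profile c a b v + (1 - alpha) * y))).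
rewrite {3}/profile; have [Ev|vc] := eqVneq v c.
  rewrite Ev /profile eqxx gdistxx mul0r add0r.
  under eq_bigr => u uc do rewrite gdist_star0 uc.
  by rewrite sumr_const cardc Ea -[_ *+ m]mulr_natl /=; ring.
rewrite /profile (negPf vc) gdist_sym // gdist_star0 vc.
rewrite (bigD1 v) //= gdistxx mul0r add0r.
under eq_bigr => u /andP [uc uv] do rewrite gdist_star // eq_sym uv.
have cardv : #|[pred u | (u != c) && (u != v)]|%:R = m%:R - 1 :> R.
  have /(congr1 (fun k => k%:R : R)) := cardD1 v (predC1 c).
  rewrite cardc inE vc natrD => ->; rewrite addrC addKr; congr _%:R.
  by apply: eq_card => u; rewrite !inE andbC.
by rewrite sumr_const -[_ *+ #|_|]mulr_natl cardv Eb /=; ring.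
Qed.

(** On the profile, with squared norm [S], the form equals [T * p + W * b ^+ 2], while [M * S]
    equals [m * p + 2 * (m * (m - 1)) * b ^+ 2]. Since [p] is positive, a strict gain in [T]
    suffices. *)
Lemma mu_gt_star (G : sgraph) (a b M : R) (c w : G) :
  is_tree G -> (exists u1 u2, [/\ adj c u1, adj c u2 & u1 != u2]) ->
  (1 < gdist c w)%N -> 0 < a -> 0 < b ->
  M * a = alpha * (#|G|.-1)%:R * a + (1 - alpha) * (#|G|.-1)%:R * b ->
  M * b = (2 * ((#|G|.-1)%:R - 1) + alpha) * b + (1 - alpha) * a ->
  M < mu alpha G.
Proof.
case=> Gconn Gacyc deg_c dw a0 b0 Ea Eb.
have := mu_rayleigh alpha (profile c a b) Gconn.
set m := #|G|.-1 in Ea Eb *.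
have cardc : #|predC1 c| = m by rewrite cardC1.
have G3 : (2 <= m)%N.
  case: deg_c => u1 [u2 [cu1 cu2 u12]]; rewrite -cardc.
  apply/card_gt1P; exists u1, u2; split=> //.
    by rewrite inE eq_sym adj_neq.
  by rewrite inE eq_sym adj_neq.
rewrite (sum_profile c a b (fun _ y => y ^+ 2)) sumr_const cardc.
rewrite (sum_profile c a b (fun v y => \sum_u (gdist v u)%:R *
  (alpha * y + (1 - alpha) * profile c a b u) * y)).
rewrite (sum_profile c a b (fun u y => (gdist c u)%:R *
  (alpha * a + (1 - alpha) * y) * a)) gdistxx !mul0r add0r.
under [X in _ + X <= _]eq_bigr => v vc.
  rewrite (sum_profile c a b (fun u y => (gdist v u)%:R *
    (alpha * b + (1 - alpha) * y) * b)).
  rewrite gdist_sym //; over.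
rewrite big_split /=.
set T := (\sum_(v | v != c) gdist c v)%N.
set W := (\sum_(v | v != c) \sum_(u | u != c) gdist v u)%N.
have -> : \sum_(v | v != c) (gdist c v)%:R * (alpha * a + (1 - alpha) * b) * a =
    T%:R * ((alpha * a + (1 - alpha) * b) * a).
  by rewrite /T natr_sum mulr_suml; apply: eq_bigr => v _; rewrite mulrA.
have -> : \sum_(v | v != c) (gdist c v)%:R * (alpha * b + (1 - alpha) * a) * b =
    T%:R * ((alpha * b + (1 - alpha) * a) * b).
  by rewrite /T natr_sum mulr_suml; apply: eq_bigr => v _; rewrite mulrA.
have -> : \sum_(v | v != c) \sum_(u | u != c)
    (gdist v u)%:R * (alpha * b + (1 - alpha) * b) * b = W%:R * b ^+ 2.
  rewrite /W natr_sum mulr_suml; apply: eq_bigr => v _.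
  by rewrite natr_sum mulr_suml; apply: eq_bigr => u _; ring.
(* The extra 1 comes from [w], at distance at least 2 from [c]. *)
have lt_T : m%:R + 1 <= T%:R :> R.
  rewrite natr1 ler_nat -cardc -sum1_card.
  have wc : w != c by apply: contraTneq dw => ->; rewrite gdistxx.
  rewrite /T (bigD1 w) //= [ltnRHS](bigD1 w) //= -addSn leq_add //.
  apply: leq_sum => v /andP [vc _].
  by rewrite lt0n gdist_eq0 // eq_sym.
have le_W : 2 * (m%:R * (m%:R - 1)) <= W%:R :> R.
  rewrite -(natrB _ (ltnW G3)) -!natrM ler_nat subn1.
  exact: sum_gdist_punctured.
move=> le_mu; have al : 0 < 1 - alpha by rewrite subr_gt0.
set S := a ^+ 2 + b ^+ 2 *+ m in le_mu.
have S0 : 0 < S by rewrite ltr_wpDr ?exprn_gt0 // mulrn_wge0 // sqr_ge0.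
rewrite -(ltr_pM2r S0); apply: lt_le_trans le_mu.
have -> : M * S = (M * a) * a + m%:R * ((M * b) * b).
  by rewrite /S -mulr_natl; ring.
set p := (alpha * a + (1 - alpha) * b) * a + (alpha * b + (1 - alpha) * a) * b.
have p0 : 0 < p.
  by rewrite addr_gt0 // mulr_gt0 // ltr_wpDl ?mulr_ge0 ?mulr_gt0 // ltW.
apply: (@lt_le_trans _ _ ((m%:R + 1) * p + 2 * (m%:R * (m%:R - 1)) * b ^+ 2)).
  rewrite Ea Eb -subr_gt0; set z := (X in 0 < X).
  by have -> : z = p by rewrite /z /p; ring.
rewrite addrA -mulrDr -/p; apply: lerD.
  by rewrite ler_wpM2r // ltW.
by rewrite ler_wpM2r // sqr_ge0.
Qed.

End Comparison.

Theorem theorem5p1 (R : realType) (alpha : R) (n : nat) (G : sgraph) :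
  0 <= alpha < 1 -> (4 <= n)%N -> is_tree G -> #|G| = n ->
  mu alpha (star n) <= mu alpha G /\
  (mu alpha G = mu alpha (star n) <-> isomorphic G (star n)).
Proof.
move=> /andP [alpha0 alpha1] n4 Gtree Gn; have [Gconn Gacyc] := Gtree.
case: n n4 Gn => // m m3 Gn.
have star_mu : isomorphic G (star m.+1) -> mu alpha G = mu alpha (star m.+1).
  by apply: isomorphic_mu => //; apply: star_connected.
have [c [u1 [u2 deg_c]]] : exists c u1 u2 : G, [/\ adj c u1, adj c u2 & u1 != u2].
  by apply: exists_branch => //; rewrite Gn ltnW.
(* Without such a [w], [c] is adjacent to all other vertices and [G] is a star; with one, the
   inequality is strict, which excludes equality. *)
have [w dw|no_w] := pickP [pred w | 1 < gdist c w]%N; last first.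
  suff GS : isomorphic G (star m.+1) by rewrite star_mu.
  rewrite -Gn; apply: (@universal_star _ c) => // v vc; rewrite -gdist_eq1 //.
  have /negbT := no_w v; rewrite /= -leqNgt.
  have : gdist c v != 0%N by rewrite gdist_eq0 // eq_sym.
  by case: (gdist c v) => [|[]].
have m0 : 0 < m%:R :> R by rewrite ltr0n; case: m m3 {Gn star_mu}.
have [a [b [M [a0 b0 Ea Eb]]]] := star_perron alpha1 m0.
have lt_mu : mu alpha (star m.+1) < mu alpha G.
  rewrite (mu_star alpha0 alpha1 a0 b0 Ea Eb).
  apply: (mu_gt_star alpha0 alpha1 Gtree _ dw a0 b0); rewrite ?Gn //.
  by exists u1, u2.
split; first exact: ltW.
by split=> [E|/star_mu //]; rewrite E ltxx in lt_mu.
Qed.
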